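(* For every integer $n\ge 0$, \[ L_n(x;q,y)=\sum_{\pi\in \mathcal{M}_n}(-1)^{e(\pi)}\,y^{\mathrm{bwex}(\pi)}\,q^{\mathrm{bwt}(\pi)+\mathrm{cross}(\pi)}\,x^{\,n-e(\pi)}, \] where $L_n(x;q,y)$ are the $q$-Laguerre polynomials and $\mathcal{M}_n$, $e$, $\mathrm{bwex}$, $\mathrm{bwt}$, $\mathrm{cross}$ are as defined in the context.
   Context: Write $[n]_q=1+q+\dots+q^{n-1}$ and $[n]=\{1,\dots,n\}$. The $q$-Laguerre polynomials $L_n(x;q,y)$ are defined by $L_0=1$, $L_1=x-y$, and for $n\ge 1$, $L_{n+1}(x;q,y)=(x-y[n+1]_q-[n]_q)L_n(x;q,y)-y[n]_q^2L_{n-1}(x;q,y)$. A matching of degree $n$ is a set $\pi$ of edges $(i,\bar j)$ with $i,j\in[n]$ (joining the ''upper vertex'' $i$ to the ''lower vertex'' $\bar j$) such that no two distinct edges share an upper vertex or share a lower vertex; $\mathcal{M}_n$ is the set of all matchings of degree $n$ (including the empty one), and $e(\pi)$ is the number of edges of $\pi$. If $(i,\bar j)\in\pi$ write $\pi(i)=j$. An upper (resp. lower) vertex is unmatched if no edge of $\pi$ contains it. The upper block index $\mathrm{bind}^U_\pi(i)$ of an upper vertex $i$ is $1$ plus the number of unmatched upper vertices $u$ with $u<i$; the lower block index $\mathrm{bind}^L_\pi(j)$ of a lower vertex $\bar j$ is $1$ plus the number of unmatched lower vertices $\bar v$ with $v<j$. For an edge $e=(i,\overline{\pi(i)})$, its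 block difference is $\mathrm{bdiff}_\pi(e)=\mathrm{bind}^L_\pi(\pi(i))-\mathrm{bind}^U_\pi(i)$. Then $\mathrm{bwex}(\pi)$ is the number of edges $e$ with $\mathrm{bdiff}_\pi(e)\ge 0$; $\mathrm{bwt}(\pi)=\sum_{e:\,\mathrm{bdiff}_\pi(e)\ge0}\mathrm{bdiff}_\pi(e)+\sum_{e:\,\mathrm{bdiff}_\pi(e)<0}(-\mathrm{bdiff}_\pi(e)-1)$; and $\mathrm{cross}(\pi)$ is the number of pairs of edges $(i,\overline{\pi(i)}),(j,\overline{\pi(j)})$ of $\pi$ with $i<j$ and $\pi(i)>\pi(j)$. *)

(* Defs.v *)
From HB Require Import structures.
From mathcomp Require Import all_boot all_order all_algebra.
Set Implicit Arguments.
Unset Strict Implicit.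
Unset Printing Implicit Defensive.
Import Order.TTheory GRing.Theory Num.Theory.
Local Open Scope ring_scope.

Definition qint (R : comNzRingType) (q : R) (n : nat) : R := \sum_(i < n) q ^+ i.

(* L_n(x; q, y), as a polynomial in x = 'X with parameters q and y in an
   arbitrary commutative ring (formal variables when R = Z[q, y]). *)
Fixpoint qLaguerre (R : comNzRingType) (q y : R) (n : nat) : {poly R} :=
  match n with
  | 0 => 1
  | m.+1 =>
    match m with
    | 0 => 'X - y%:P
    | k.+1 =>
      ('X - (y * qint q m.+1)%:P - (qint q m)%:P) * qLaguerre q y m
      - (y * qint q m ^+ 2)%:P * qLaguerre q y k
    end
  end.

Local Open Scope nat_scope.

(* The edge (i, j) joins the upper vertex i to the lower vertex \bar j.
   Vertices are numbered 0, ..., n - 1 rather than 1, ..., n; all the statistics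
   below depend only on the order of the vertices. *)
Definition edge (n : nat) : Type := ('I_n * 'I_n)%type.

Definition is_matching (n : nat) (pi : {set edge n}) : bool :=
  [forall e in pi, forall f in pi, (e != f) ==> (e.1 != f.1) && (e.2 != f.2)].

Definition matchings (n : nat) : {set {set edge n}} :=
  [set pi : {set edge n} | is_matching pi].

Definition unmatchedU (n : nat) (pi : {set edge n}) (i : 'I_n) : bool :=
  [forall e in pi, e.1 != i].
Definition unmatchedL (n : nat) (pi : {set edge n}) (j : 'I_n) : bool :=
  [forall e in pi, e.2 != j].

Definition bindU (n : nat) (pi : {set edge n}) (i : 'I_n) : nat :=
  1 + #|[set u : 'I_n | unmatchedU pi u & u < i]|.
Definition bindL (n : nat) (pi : {set edge n}) (j : 'I_n) : nat :=
  1 + #|[set v : 'I_n | unmatchedL pi v & v < j]|.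

Definition bdiff (n : nat) (pi : {set edge n}) (e : edge n) : int :=
  ((bindL pi e.2)%:Z - (bindU pi e.1)%:Z)%R.

Definition bwex (n : nat) (pi : {set edge n}) : nat :=
  #|[set e in pi | (0 <= bdiff pi e)%R]|.

(* Each integer under `| _ |%N is nonnegative on its range of summation. *)
Definition bwt (n : nat) (pi : {set edge n}) : nat :=
  \sum_(e in pi | (0 <= bdiff pi e)%R) `|(bdiff pi e)%R|
  + \sum_(e in pi | (bdiff pi e < 0)%R) `|(- bdiff pi e - 1)%R|.

Definition cross (n : nat) (pi : {set edge n}) : nat :=
  #|[set p : edge n * edge n | [&& p.1 \in pi, p.2 \in pi,
                               p.1.1 < p.2.1 & p.1.2 > p.2.2]]|.

(* Main.v *)
Require Import Defs.
From HB Require Import structures.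
From mathcomp Require Import all_boot all_order all_algebra zify ring.
Import Order.TTheory GRing.Theory Num.Theory.
Set Implicit Arguments.
Unset Strict Implicit.
Unset Printing Implicit Defensive.
Local Open Scope nat_scope.

(** Let [W n] be the signed weighted sum over matchings of degree [n]. Deleting
    the edge at the last lower vertex, whose upper end is the [i]-th from the
    right ([i >= 0]), divides the weight by [- y q^i]: the block difference
    counts the unmatched upper vertices to the right of that end, and the new
    crossings count the matched ones. Hence the matchings of degree [n] whose
    last lower vertex is matched contribute [- y [n]_q W (n-1)]. When the last
    lower vertex is unmatched and the last upper vertex is matched, deleting the
    edge at the latter leaves an arbitrary matching of degree [n - 1] with
    unmatched last lower vertex, and the weights of the deleted edges sum to
    [- [n-1]_q]. Thus
      W (n+1) = x W n - y [n+1]_q W n - [n]_q (W n + y [n]_q W (n-1)),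
    the three terms being: both last vertices unmatched; last lower vertex
    matched; only the last upper vertex matched. This is the recurrence of the
    q-Laguerre polynomials. *)

(** * Inserting vertices and edges into matchings, and deleting them *)

Section Insertion.
Variables (n : nat) (i j : 'I_n.+1).
Implicit Type pi : {set edge n}.

Definition lift_edge (e : edge n) : edge n.+1 := (lift i e.1, lift j e.2).
(* [emb] makes room for an upper vertex [i] and a lower vertex [j], both
   unmatched; [ins] then joins them. *)
Definition emb pi : {set edge n.+1} := lift_edge @: pi.
Definition ins pi : {set edge n.+1} := (i, j) |: emb pi.
(** As a preimage under [lift_edge], this drops every edge at the upper vertex [i] or at the lower
    vertex [j], hence inverts both [emb] and [ins]. *)
Definition del (pi : {set edge n.+1}) : {set edge n} := lift_edge @^-1: pi.

Lemma lift_edge_inj : injective lift_edge.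
Proof.
case=> a b [c d] /eqP; rewrite xpair_eqE !(inj_eq (@lift_inj _ _)).
by case/andP => /eqP/= -> /eqP/= ->.
Qed.

Lemma lift_edge_in_emb pi e : (lift_edge e \in emb pi) = (e \in pi).
Proof. exact/mem_imset/lift_edge_inj. Qed.

Lemma new_edge_notin_emb pi : (i, j) \notin emb pi.
Proof. by apply/imsetP => -[e _ [/eqP]]; rewrite (negPf (neq_lift _ _)). Qed.

Lemma unmatchedU_emb_new pi : unmatchedU (emb pi) i.
Proof. by apply/forall_inP => _ /imsetP[e _ ->]; rewrite eq_sym neq_lift. Qed.

Lemma unmatchedL_emb_new pi : unmatchedL (emb pi) j.
Proof. by apply/forall_inP => _ /imsetP[e _ ->]; rewrite eq_sym neq_lift. Qed.

Lemma unmatchedU_emb pi u : unmatchedU (emb pi) (lift i u) = unmatchedU pi u.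
Proof.
apply/forall_inP/forall_inP => [h e epi | h _ /imsetP[e /h eu ->]].
  by have := h _ (imset_f lift_edge epi); rewrite (inj_eq (@lift_inj _ _)).
by rewrite (inj_eq (@lift_inj _ _)).
Qed.

Lemma unmatchedL_emb pi u : unmatchedL (emb pi) (lift j u) = unmatchedL pi u.
Proof.
apply/forall_inP/forall_inP => [h e epi | h _ /imsetP[e /h eu ->]].
  by have := h _ (imset_f lift_edge epi); rewrite (inj_eq (@lift_inj _ _)).
by rewrite (inj_eq (@lift_inj _ _)).
Qed.

Lemma unmatchedU_ins pi u : unmatchedU (ins pi) u = (u != i) && unmatchedU (emb pi) u.
Proof.
apply/forall_inP/andP => [h | [ui /forall_inP h] e].
  split; first by rewrite eq_sym (h _ (setU11 _ _)).
  by apply/forall_inP => e epi; apply/h/setU1r.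
by case/setU1P => [-> | /h //]; rewrite eq_sym.
Qed.

Lemma unmatchedL_ins pi u : unmatchedL (ins pi) u = (u != j) && unmatchedL (emb pi) u.
Proof.
apply/forall_inP/andP => [h | [ui /forall_inP h] e].
  split; first by rewrite eq_sym (h _ (setU11 _ _)).
  by apply/forall_inP => e epi; apply/h/setU1r.
by case/setU1P => [-> | /h //]; rewrite eq_sym.
Qed.

Lemma matching_emb pi : is_matching (emb pi) = is_matching pi.
Proof.
apply/forall_inP/forall_inP => [h e epi | h _ /imsetP[e /h he ->]].
  apply/forall_inP => f fpi; have := forall_inP (h _ (imset_f lift_edge epi)).
  move=> /(_ _ (imset_f lift_edge fpi)).
  by rewrite (inj_eq lift_edge_inj) !(inj_eq (@lift_inj _ _)).
apply/forall_inP => _ /imsetP[f /(forall_inP he) hf ->].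
by rewrite (inj_eq lift_edge_inj) !(inj_eq (@lift_inj _ _)).
Qed.

Lemma matching_ins pi : is_matching (ins pi) = is_matching pi.
Proof.
rewrite -matching_emb; apply/forall_inP/forall_inP => h e epi.
  apply/forall_inP => f fpi.
  exact: (forall_inP (h _ (setU1r _ epi)) _ (setU1r _ fpi)).
apply/forall_inP => f fpi.
case/setU1P: epi => [-> | epi]; case/setU1P: fpi => [-> | fpi].
- by rewrite eqxx.
- by case/imsetP: fpi => g _ ->; rewrite !neq_lift implybT.
- by case/imsetP: epi => g _ ->; rewrite ![_ == i]eq_sym ![_ == j]eq_sym !neq_lift implybT.
- exact: (forall_inP (h _ epi) _ fpi).
Qed.

Lemma insK : cancel ins del.
Proof.
move=> pi; apply/setP => e; rewrite !inE lift_edge_in_emb.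
by rewrite /lift_edge xpair_eqE eq_sym (negPf (neq_lift _ _)).
Qed.

Lemma embK : cancel emb del.
Proof. by move=> pi; apply/setP => e; rewrite !inE lift_edge_in_emb. Qed.

Lemma delK_emb (pi : {set edge n.+1}) :
  unmatchedU pi i -> unmatchedL pi j -> emb (del pi) = pi.
Proof.
move=> /forall_inP hi /forall_inP hj; apply/setP => -[a b]; apply/imsetP/idP.
  by case=> e; rewrite inE => h ->.
move=> h; have /= := hi _ h; have /= := hj _ h; move: h.
case: (unliftP i a) => [a'|] ->; last by rewrite eqxx.
case: (unliftP j b) => [b'|] ->; last by rewrite eqxx.
by move=> h _ _; exists (a', b'); rewrite ?inE.
Qed.

(** In a matching that contains [(i, j)], every other edge avoids both [i] and [j], so it is a
    lifted edge and survives the deletion. *)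
Lemma delK_ins (pi : {set edge n.+1}) :
  is_matching pi -> (i, j) \in pi -> ins (del pi) = pi.
Proof.
move=> /forall_inP m ijpi; apply/setP => e; apply/setU1P/idP.
  by case=> [-> // | /imsetP[f]]; rewrite inE => h ->.
move=> h; have := forall_inP (m _ h) _ ijpi; case: eqVneq => [|_ /=]; first by left.
case: e h => a b h /=.
case: (unliftP i a) h => [a'|] ->; last by rewrite eqxx.
case: (unliftP j b) => [b'|] -> h; last by rewrite eqxx andbF.
by right; apply/imsetP; exists (a', b'); rewrite ?inE.
Qed.

Lemma sum_matchings_emb (V : nmodType) (F : {set edge n.+1} -> V) :
  (\sum_(pi in matchings n.+1 | unmatchedL pi j && unmatchedU pi i) F pi
   = \sum_(pi in matchings n) F (emb pi))%R.
Proof.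
rewrite (reindex_onto emb del) => [|pi /and3P[_ L U]]; last exact: delK_emb.
apply: eq_bigl => pi; rewrite !inE matching_emb embK eqxx.
by rewrite unmatchedU_emb_new unmatchedL_emb_new !andbT.
Qed.

Lemma sum_matchings_ins (V : nmodType) (P : pred {set edge n.+1})
    (F : {set edge n.+1} -> V) :
  (\sum_(pi in matchings n.+1 | P pi && ((i, j) \in pi)) F pi
   = \sum_(pi in matchings n | P (ins pi)) F (ins pi))%R.
Proof.
rewrite (reindex_onto ins del) => [|pi /and3P[]]; last first.
  by rewrite inE => ? _ ?; apply: delK_ins.
by apply: eq_bigl => pi; rewrite !inE matching_ins insK !eqxx /= !andbT.
Qed.

Lemma card_emb pi : #|emb pi| = #|pi|.
Proof. exact/card_imset/lift_edge_inj. Qed.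

Lemma card_ins pi : #|ins pi| = #|pi|.+1.
Proof. by rewrite cardsU1 new_edge_notin_emb card_emb. Qed.

Lemma sum_emb pi (F : edge n.+1 -> nat) :
  \sum_(e in emb pi) F e = \sum_(e in pi) F (lift_edge e).
Proof. by rewrite big_imset // => ? ? _ _; apply: lift_edge_inj. Qed.

Lemma sum_ins pi (F : edge n.+1 -> nat) :
  \sum_(e in ins pi) F e = F (i, j) + \sum_(e in pi) F (lift_edge e).
Proof. by rewrite big_setU1 ?new_edge_notin_emb //= sum_emb. Qed.

End Insertion.

(** * Order and counting around an inserted vertex *)

Lemma lift_ltn n (i : 'I_n.+1) (u v : 'I_n) : (lift i u < lift i v) = (u < v).
Proof. by rewrite /= !ltnNge leq_bump2. Qed.

Lemma lift_ltn_self n (i : 'I_n.+1) (u : 'I_n) : (lift i u < i) = (u < i).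
Proof. rewrite /= /bump; lia. Qed.

Lemma self_ltn_lift n (i : 'I_n.+1) (u : 'I_n) : (i < lift i u) = (i <= u).
Proof. rewrite /= /bump; lia. Qed.

Lemma card_lift n (i : 'I_n.+1) (P : pred 'I_n.+1) :
  #|[set v | P v]| = P i + #|[set v | P (lift i v)]|.
Proof.
rewrite -!sum1dep_card; case: (boolP (P i)) => Pi; first by rewrite (bigD1_ord i).
rewrite add0n big_mkcond (bigD1_ord i) //= (negPf Pi) add0n [RHS]big_mkcond.
exact: eq_bigr.
Qed.

(** * Block indices, block weights and crossings under insertion *)

Section Statistics.
Variable n : nat.
Implicit Type pi : {set edge n}.

(** Block indices count unmatched vertices only, and the inserted vertex [i] is matched. Hence old
    edges keep their block differences. *)
Lemma bindU_ins (i j : 'I_n.+1) pi u : bindU (ins i j pi) (lift i u) = bindU pi u.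
Proof.
rewrite /bindU (card_lift i) unmatchedU_ins eqxx add0n.
congr (1 + _); apply: eq_card => v.
by rewrite !inE unmatchedU_ins unmatchedU_emb eq_sym neq_lift lift_ltn.
Qed.

Lemma bindL_ins (i j : 'I_n.+1) pi u : bindL (ins i j pi) (lift j u) = bindL pi u.
Proof.
rewrite /bindL (card_lift j) unmatchedL_ins eqxx add0n.
congr (1 + _); apply: eq_card => v.
by rewrite !inE unmatchedL_ins unmatchedL_emb eq_sym neq_lift lift_ltn.
Qed.

Lemma bindU_ins_new (i j : 'I_n.+1) pi :
  bindU (ins i j pi) i = 1 + #|[set u | unmatchedU pi u & u < i]|.
Proof.
rewrite /bindU (card_lift i) unmatchedU_ins eqxx add0n.
congr (1 + _); apply: eq_card => v.
by rewrite !inE unmatchedU_ins unmatchedU_emb eq_sym neq_lift lift_ltn_self.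
Qed.

Lemma bindL_ins_new (i j : 'I_n.+1) pi :
  bindL (ins i j pi) j = 1 + #|[set u | unmatchedL pi u & u < j]|.
Proof.
rewrite /bindL (card_lift j) unmatchedL_ins eqxx add0n.
congr (1 + _); apply: eq_card => v.
by rewrite !inE unmatchedL_ins unmatchedL_emb eq_sym neq_lift lift_ltn_self.
Qed.

(** The new vertex is unmatched, but being last it lies to the left of no old vertex. *)
Lemma bindU_emb_max (j : 'I_n.+1) pi u :
  bindU (emb ord_max j pi) (lift ord_max u) = bindU pi u.
Proof.
have lt_max : (@ord_max n < lift ord_max u) = false by rewrite lift_max ltnNge ltnW /=.
rewrite /bindU (card_lift ord_max) lt_max andbF add0n.
congr (1 + _); apply: eq_card => v.
by rewrite !inE unmatchedU_emb lift_ltn.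
Qed.

Lemma bindL_emb_max (i : 'I_n.+1) pi u :
  bindL (emb i ord_max pi) (lift ord_max u) = bindL pi u.
Proof.
have lt_max : (@ord_max n < lift ord_max u) = false by rewrite lift_max ltnNge ltnW /=.
rewrite /bindL (card_lift ord_max) lt_max andbF add0n.
congr (1 + _); apply: eq_card => v.
by rewrite !inE unmatchedL_emb lift_ltn.
Qed.

Lemma bwexE pi : bwex pi = \sum_(e in pi) (0 <= bdiff pi e)%R.
Proof.
rewrite /bwex -sum1dep_card big_mkcondr /=.
by apply: eq_bigr => e _; case: (0 <= _)%R.
Qed.

(** Contribution to [bwt] of one edge with block difference [d]. It merges the two sums of [bwt]
    into one over all edges, to which [sum_ins] and [sum_emb] apply. *)
Definition ebwt (d : int) : nat :=
  if (0 <= d)%R then `|d|%N else `|(- d - 1)%R|%N.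

Lemma bwtE pi : bwt pi = \sum_(e in pi) ebwt (bdiff pi e).
Proof.
rewrite /bwt [RHS](bigID (fun e => 0 <= bdiff pi e)%R) /=; congr (_ + _).
  by apply: eq_bigr => e /andP[_]; rewrite /ebwt => ->.
apply: eq_big => [e | e /andP[_ d0]]; first by rewrite ltNge.
by rewrite /ebwt leNgt d0.
Qed.

Definition ecross m (e f : edge m) : bool := (e.1 < f.1) && (f.2 < e.2).

Lemma crossE m (pi : {set edge m}) :
  cross pi = \sum_(e in pi) \sum_(f in pi) ecross e f.
Proof.
rewrite /cross -sum1dep_card pair_big /=.
under eq_bigl => p do rewrite andbA.
by rewrite big_mkcondr; apply: eq_bigr => p _; rewrite /ecross; case: (_ && _).
Qed.

Lemma ecross_lift (i j : 'I_n.+1) e f :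
  ecross (lift_edge i j e) (lift_edge i j f) = ecross e f.
Proof. by rewrite /ecross !lift_ltn. Qed.

Lemma cross_emb (i j : 'I_n.+1) pi : cross (emb i j pi) = cross pi.
Proof.
rewrite !crossE sum_emb; apply: eq_bigr => e _; rewrite sum_emb.
by apply: eq_bigr => f _; rewrite ecross_lift.
Qed.

(** The two added sums count the old edges that cross the new one from its upper left and from its
    upper right. In the old numbering, a vertex to the right of [i] is one that is at least [i]. *)
Lemma cross_ins (i j : 'I_n.+1) pi :
  cross (ins i j pi) = cross pi
    + \sum_(e in pi) ((e.1 < i) && (j <= e.2))
    + \sum_(e in pi) ((i <= e.1) && (e.2 < j)).
Proof.
rewrite !crossE !sum_ins {1}/ecross ltnn add0n.
under [X in _ + X]eq_bigr => e _ do rewrite sum_ins.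
rewrite big_split /= addnC [X in X + _]addnC; congr (_ + _ + _).
- by do 2![apply: eq_bigr => ? _]; rewrite ecross_lift.
- by apply: eq_bigr => e _; rewrite /ecross lift_ltn_self self_ltn_lift.
- by apply: eq_bigr => e _; rewrite /ecross lift_ltn_self self_ltn_lift.
Qed.

(** * Counting matched and unmatched vertices *)

Lemma matching_injU pi : is_matching pi -> {in pi &, injective (fun e : edge n => e.1)}.
Proof.
move=> /forall_inP m e f /m /forall_inP me /me; case: eqVneq => //= _.
by case/andP => /eqP.
Qed.

Lemma matching_injL pi : is_matching pi -> {in pi &, injective (fun e : edge n => e.2)}.
Proof.
move=> /forall_inP m e f /m /forall_inP me /me; case: eqVneq => //= _.
by case/andP => _ /eqP.
Qed.

(** Each matched upper vertex lies on exactly one edge, so the sum over edges counts the matched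
    vertices in [P]. This is what later merges block differences and crossings into one vertex
    count. *)
Lemma card_upper pi (P : pred 'I_n) : is_matching pi ->
  #|[set u | unmatchedU pi u & P u]| + \sum_(e in pi) P e.1 = #|[set u | P u]|.
Proof.
move=> m; rewrite -(cardsID [set u | unmatchedU pi u] [set u | P u]); congr (_ + _).
  by apply: eq_card => u; rewrite !inE andbC.
have -> : [set u | P u] :\: [set u | unmatchedU pi u]
   = (fun e : edge n => e.1) @: [set e in pi | P e.1].
  apply/setP => u; rewrite !inE; apply/andP/imsetP => [[/forall_inPn[e epi /negPn/eqP eu]] Pu|].
    by exists e => //; rewrite inE epi eu.
  case=> e; rewrite inE => /andP[epi Pe] ->; split=> //.
  by apply/forall_inPn; exists e => //; rewrite eqxx.
rewrite card_in_imset => [|e f]; last first.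
  by rewrite !inE => /andP[? _] /andP[? _]; apply: (matching_injU m).
rewrite -sum1dep_card big_mkcondr /=.
by apply: eq_bigr => e _; case: (P _).
Qed.

Lemma card_lower pi (P : pred 'I_n) : is_matching pi ->
  #|[set u | unmatchedL pi u & P u]| + \sum_(e in pi) P e.2 = #|[set u | P u]|.
Proof.
move=> m; rewrite -(cardsID [set u | unmatchedL pi u] [set u | P u]); congr (_ + _).
  by apply: eq_card => u; rewrite !inE andbC.
have -> : [set u | P u] :\: [set u | unmatchedL pi u]
   = (fun e : edge n => e.2) @: [set e in pi | P e.2].
  apply/setP => u; rewrite !inE; apply/andP/imsetP => [[/forall_inPn[e epi /negPn/eqP eu]] Pu|].
    by exists e => //; rewrite inE epi eu.
  case=> e; rewrite inE => /andP[epi Pe] ->; split=> //.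
  by apply/forall_inPn; exists e => //; rewrite eqxx.
rewrite card_in_imset => [|e f]; last first.
  by rewrite !inE => /andP[? _] /andP[? _]; apply: (matching_injL m).
rewrite -sum1dep_card big_mkcondr /=.
by apply: eq_bigr => e _; case: (P _).
Qed.
End Statistics.

Lemma card_ltn_ord n k : k <= n -> #|[set u : 'I_n | u < k]| = k.
Proof.
by move=> kn; rewrite -sum1dep_card -(big_ord_widen n (fun=> 1) kn) sum_nat_const card_ord muln1.
Qed.

Lemma card_geq_ord n k : k <= n -> #|[set u : 'I_n | k <= u]| = n - k.
Proof.
move=> kn; have := cardsC [set u : 'I_n | u < k]; rewrite card_ltn_ord // card_ord.
have -> : ~: [set u : 'I_n | u < k] = [set u : 'I_n | k <= u].
  by apply/setP => u; rewrite !inE -leqNgt.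
lia.
Qed.

(** * Statistics of an edge inserted at a last vertex *)

Section InsertionStatistics.
Variables (n : nat) (pi : {set edge n}).
Hypothesis pi_matching : is_matching pi.

Lemma card_unmatchedU : #|[set u | unmatchedU pi u]| + #|pi| = n.
Proof.
have := card_upper xpredT pi_matching; rewrite cardsT card_ord sum1_card.
by under eq_finset => u do rewrite andbT.
Qed.

Lemma card_unmatchedL : #|[set u | unmatchedL pi u]| + #|pi| = n.
Proof.
have := card_lower xpredT pi_matching; rewrite cardsT card_ord sum1_card.
by under eq_finset => u do rewrite andbT.
Qed.

Lemma bdiff_ins (i j : 'I_n.+1) e :
  bdiff (ins i j pi) (lift_edge i j e) = bdiff pi e.
Proof. by rewrite /bdiff bindU_ins bindL_ins. Qed.

Lemma bdiff_emb_max e :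
  bdiff (emb ord_max ord_max pi) (lift_edge ord_max ord_max e) = bdiff pi e.
Proof. by rewrite /bdiff bindU_emb_max bindL_emb_max. Qed.

Lemma bwex_ins (i j : 'I_n.+1) :
  bwex (ins i j pi) = (0 <= bdiff (ins i j pi) (i, j))%R + bwex pi.
Proof.
by rewrite !bwexE sum_ins; congr (_ + _); apply: eq_bigr => e _; rewrite bdiff_ins.
Qed.

Lemma bwt_ins (i j : 'I_n.+1) :
  bwt (ins i j pi) = ebwt (bdiff (ins i j pi) (i, j)) + bwt pi.
Proof.
by rewrite !bwtE sum_ins; congr (_ + _); apply: eq_bigr => e _; rewrite bdiff_ins.
Qed.

Lemma bwex_emb_max : bwex (emb ord_max ord_max pi) = bwex pi.
Proof. by rewrite !bwexE sum_emb; apply: eq_bigr => e _; rewrite bdiff_emb_max. Qed.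

Lemma bwt_emb_max : bwt (emb ord_max ord_max pi) = bwt pi.
Proof. by rewrite !bwtE sum_emb; apply: eq_bigr => e _; rewrite bdiff_emb_max. Qed.

(** No old lower vertex lies to the right of the new one, so only crossings from the upper right
    remain. *)
Lemma cross_ins_lower_max (i : 'I_n.+1) :
  cross (ins i ord_max pi) = cross pi + \sum_(e in pi) (i <= e.1).
Proof.
rewrite cross_ins big1 => [|e _]; last by rewrite (leqNgt (@ord_max n)) ltn_ord andbF.
by rewrite addn0; congr (_ + _); apply: eq_bigr => e _; rewrite ltn_ord andbT.
Qed.

Lemma cross_ins_upper_max (j : 'I_n.+1) :
  cross (ins ord_max j pi) = cross pi + \sum_(e in pi) (j <= e.2).
Proof.
rewrite cross_ins [X in _ + X]big1 => [|e _]; last by rewrite (leqNgt (@ord_max n)) ltn_ord.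
by rewrite addn0; congr (_ + _); apply: eq_bigr => e _; rewrite ltn_ord.
Qed.

(** All unmatched lower vertices precede the new one, and they are as many as the unmatched upper
    vertices; subtracting the upper ones left of [i] leaves those to its right. *)
Lemma bdiff_ins_lower_max (i : 'I_n.+1) :
  bdiff (ins i ord_max pi) (i, ord_max) = Posz #|[set u | unmatchedU pi u & i <= u]|.
Proof.
rewrite /bdiff bindU_ins_new bindL_ins_new.
under eq_finset => u do rewrite ltn_ord andbT.
have := cardsID [set u : 'I_n | u < i] [set u | unmatchedU pi u].
have -> : [set u | unmatchedU pi u] :&: [set u : 'I_n | u < i]
   = [set u | unmatchedU pi u & u < i] by apply/setP => u; rewrite !inE.
have -> : [set u | unmatchedU pi u] :\: [set u : 'I_n | u < i]
   = [set u | unmatchedU pi u & i <= u].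
  by apply/setP => u; rewrite !inE -leqNgt andbC.
have := card_unmatchedU; have := card_unmatchedL.
by do 5![move: #|_| => ?]; lia.
Qed.

Lemma bdiff_ins_upper_max (j : 'I_n.+1) :
  bdiff (ins ord_max j pi) (ord_max, j) = (- Posz #|[set u | unmatchedL pi u & (j <= u)%N]|)%R.
Proof.
rewrite /bdiff bindU_ins_new bindL_ins_new.
have -> : [set u | unmatchedU pi u & u < @ord_max n] = [set u | unmatchedU pi u].
  by apply/setP => u; rewrite !inE ltn_ord andbT.
have := cardsID [set u : 'I_n | u < j] [set u | unmatchedL pi u].
have -> : [set u | unmatchedL pi u] :&: [set u : 'I_n | u < j]
   = [set u | unmatchedL pi u & u < j] by apply/setP => u; rewrite !inE.
have -> : [set u | unmatchedL pi u] :\: [set u : 'I_n | u < j]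
   = [set u | unmatchedL pi u & j <= u].
  by apply/setP => u; rewrite !inE -leqNgt andbC.
have := card_unmatchedU; have := card_unmatchedL.
by do 5![move: #|_| => ?]; lia.
Qed.

Lemma bwex_ins_lower_max (i : 'I_n.+1) : bwex (ins i ord_max pi) = (bwex pi).+1.
Proof. by rewrite bwex_ins bdiff_ins_lower_max. Qed.

(** Of the [n - i] old upper vertices to the right of [i], the unmatched ones add to [bwt] and the
    matched ones to [cross]. *)
Lemma bwt_cross_ins_lower_max (i : 'I_n.+1) :
  bwt (ins i ord_max pi) + cross (ins i ord_max pi) = n - i + (bwt pi + cross pi).
Proof.
rewrite bwt_ins cross_ins_lower_max bdiff_ins_lower_max /ebwt /=.
have := card_upper (fun u : 'I_n => i <= u) pi_matching.
by rewrite card_geq_ord -1?ltnS //; move: #|_| (\sum_(e in pi) _) => s t; lia.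
Qed.

(** An unmatched lower vertex to the right of [j] makes the new block difference strictly negative,
    so no factor [y] appears. *)
Lemma bwex_ins_upper_max (j : 'I_n.+1) :
  0 < #|[set u | unmatchedL pi u & j <= u]| -> bwex (ins ord_max j pi) = bwex pi.
Proof. by rewrite bwex_ins bdiff_ins_upper_max; move: #|_| => s; lia. Qed.

(** Again unmatched and matched vertices to the right of [j] together give [n - j]; the predecessor
    is the [- 1] in [bwt] for negative block differences. *)
Lemma bwt_cross_ins_upper_max (j : 'I_n.+1) :
  0 < #|[set u | unmatchedL pi u & j <= u]| ->
  bwt (ins ord_max j pi) + cross (ins ord_max j pi) = (n - j).-1 + (bwt pi + cross pi).
Proof.
move=> s0; rewrite bwt_ins cross_ins_upper_max bdiff_ins_upper_max /ebwt.
have := card_lower (fun u : 'I_n => j <= u) pi_matching.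
rewrite card_geq_ord -1?ltnS //; move: s0; move: #|_| (\sum_(e in pi) _) => s t.
by case: ifP; lia.
Qed.

End InsertionStatistics.

Local Open Scope ring_scope.

(** * Weights of matchings under insertion *)

Section Weight.
Variables (R : comNzRingType) (q y : R).

Definition mweight n (pi : {set edge n}) : {poly R} :=
  ((-1) ^+ #|pi| * y ^+ bwex pi * q ^+ (bwt pi + cross pi)%N) *: 'X^(n - #|pi|).

Lemma mweight_emb_max n (pi : {set edge n}) : is_matching pi ->
  mweight (emb ord_max ord_max pi) = 'X * mweight pi.
Proof.
move=> m; rewrite /mweight card_emb bwex_emb_max bwt_emb_max cross_emb.
(* Subtraction is truncated, so [subSn] requires [#|pi| <= n], which holds for matchings. *)
rewrite -scalerAr -exprS subSn //; have := card_unmatchedU m; lia.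
Qed.

Lemma mweight_ins_lower_max n (i : 'I_n.+1) (pi : {set edge n}) : is_matching pi ->
  mweight (ins i ord_max pi) = - (y * q ^+ (n - i)) *: mweight pi.
Proof.
move=> m; rewrite /mweight card_ins bwex_ins_lower_max // bwt_cross_ins_lower_max //.
by rewrite subSS scalerA exprD !exprS; congr (_ *: _); ring.
Qed.

(** Widening [j] excludes the last lower position, so the last lower vertex stays last and
    unmatched. *)
Lemma mweight_ins_upper_max n (j : 'I_n.+1) (pi : {set edge n.+1}) :
  is_matching pi -> unmatchedL pi ord_max ->
  mweight (ins ord_max (widen_ord (leqnSn _) j) pi) = - q ^+ (n - j) *: mweight pi.
Proof.
move=> m Lmax.
have s0 : (0 < #|[set u | unmatchedL pi u & (widen_ord (leqnSn n.+1) j <= u)%N]|)%N.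
  (* The last lower vertex is the required unmatched vertex. *)
  by apply/card_gt0P; exists ord_max; rewrite inE Lmax -ltnS /=.
rewrite /mweight card_ins bwex_ins_upper_max // bwt_cross_ins_upper_max //=.
have -> : ((n.+1 - j).-1 = n - j)%N by lia.
by rewrite subSS scalerA exprD !exprS; congr (_ *: _); ring.
Qed.

(** * The signed sum over matchings and its recurrence *)

Definition msum n : {poly R} := \sum_(pi in matchings n) mweight pi.

Lemma qint_rev n : qint q n.+1 = \sum_(i < n.+1) q ^+ (n - i).
Proof. by rewrite /qint (reindex_inj rev_ord_inj); apply: eq_bigr => i _; rewrite /= subSS. Qed.

(** Exactly one edge ends at a matched [j], so after exchanging the sums the inner one has a single
    term; for unmatched [j] it is empty. *)
Lemma sum_matchedL n (j : 'I_n.+1) (F : {set edge n.+1} -> {poly R}) :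
  \sum_(pi in matchings n.+1 | ~~ unmatchedL pi j) F pi
   = \sum_(i < n.+1) \sum_(pi in matchings n.+1 | (i, j) \in pi) F pi.
Proof.
rewrite (exchange_big_dep (mem (matchings n.+1))) /=; last by move=> i pi _ /andP[].
rewrite big_mkcondr; apply: eq_bigr => pi; rewrite inE => m.
case: ifPn => [/forall_inPn[[a b] abpi /negPn/eqP /= bj] | /negPn/forall_inP L].
  rewrite (big_pred1 a) // => i; rewrite inE m /= -bj; apply/idP/eqP => [|-> //].
  by move=> ibpi; have [] := matching_injL m ibpi abpi erefl.
by rewrite big_pred0 // => i; apply/negP => /andP[_ /L]; rewrite eqxx.
Qed.

Lemma sum_matchedU n (i : 'I_n.+1) (P : pred {set edge n.+1}) (F : {set edge n.+1} -> {poly R}) :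
  \sum_(pi in matchings n.+1 | P pi && ~~ unmatchedU pi i) F pi
   = \sum_(j < n.+1) \sum_(pi in matchings n.+1 | P pi && ((i, j) \in pi)) F pi.
Proof.
rewrite (exchange_big_dep (fun pi => (pi \in matchings n.+1) && P pi)) /=; last first.
  by move=> j pi _ /and3P[-> ->].
under eq_bigl => pi do rewrite andbA.
rewrite big_mkcondr; apply: eq_bigr => pi; rewrite inE => /andP[m Ppi].
case: ifPn => [/forall_inPn[[a b] abpi /negPn/eqP /= ai] | /negPn/forall_inP U].
  rewrite (big_pred1 b) // => j; rewrite inE m Ppi /= -ai; apply/idP/eqP => [|-> //].
  by move=> ajpi; have [] := matching_injU m ajpi abpi erefl.
by rewrite big_pred0 // => j; apply/negP => /and3P[_ _ /U]; rewrite eqxx.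
Qed.

Lemma msum_matchedL n :
  \sum_(pi in matchings n.+1 | ~~ unmatchedL pi ord_max) mweight pi
   = - (y * qint q n.+1) *: msum n.
Proof.
rewrite sum_matchedL qint_rev mulr_sumr -sumrN scaler_suml; apply: eq_bigr => i _.
rewrite (sum_matchings_ins i ord_max xpredT) /msum scaler_sumr.
rewrite big_andbC /=.
by apply: eq_bigr => pi; rewrite inE => m; rewrite mweight_ins_lower_max.
Qed.

Lemma msum_unmatchedL n :
  \sum_(pi in matchings n.+1 | unmatchedL pi ord_max) mweight pi
   = msum n.+1 + (y * qint q n.+1) *: msum n.
Proof.
rewrite {1}/msum [in RHS](bigID (fun pi => unmatchedL pi ord_max)) /=.
by rewrite msum_matchedL scaleNr addrNK.
Qed.

Lemma msum_unmatchedL_matchedU n :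
  \sum_(pi in matchings n.+2 | unmatchedL pi ord_max && ~~ unmatchedU pi ord_max) mweight pi
   = - qint q n.+1 *: (msum n.+1 + (y * qint q n.+1) *: msum n).
Proof.
(* The term for the last lower vertex is empty, as that vertex is unmatched; the other [n.+1]
   positions give the powers of [qint q n.+1]. *)
rewrite sum_matchedU big_ord_recr /= [X in _ + X]big1 ?addr0; last first.
  by move=> pi /and3P[_ /forall_inP L /L]; rewrite eqxx.
rewrite -msum_unmatchedL [in RHS]qint_rev -sumrN scaler_suml; apply: eq_bigr => j _.
rewrite sum_matchings_ins scaler_sumr.
(* The new lower vertex is not last, so the last one is old and its status is unchanged by the
   insertion. *)
have max_lift : ord_max = lift (widen_ord (leqnSn n.+1) j) ord_max.
  by apply: val_inj; rewrite /= /bump -ltnS ltn_ord.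
have insL pi : unmatchedL (ins ord_max (widen_ord (leqnSn n.+1) j) pi) ord_max
             = unmatchedL pi ord_max.
  by rewrite [X in unmatchedL _ X]max_lift unmatchedL_ins unmatchedL_emb eq_sym neq_lift.
under eq_bigl => pi do rewrite insL.
by apply: eq_bigr => pi /andP[]; rewrite inE => m L; rewrite mweight_ins_upper_max.
Qed.

Lemma msum_unmatched n :
  \sum_(pi in matchings n.+1 | unmatchedL pi ord_max && unmatchedU pi ord_max) mweight pi
   = 'X * msum n.
Proof.
rewrite sum_matchings_emb /msum mulr_sumr.
by apply: eq_bigr => pi; rewrite inE => m; rewrite mweight_emb_max.
Qed.

Lemma msum0 : msum 0 = 1.
Proof.
rewrite /msum (big_pred1 set0) => [|pi]; last first.
  rewrite inE /=; have -> : pi = set0 by apply/setP => -[[]].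
  by rewrite eqxx; apply/forall_inP => -[[]].
by rewrite /mweight cards0 bwexE bwtE crossE !big_set0 !expr0 !mulr1 scale1r.
Qed.

(** The third class is left as a sum so that the identity also covers [n = 0], where that class is
    empty. *)
Lemma msumS n : msum n.+1 =
  'X * msum n - (y * qint q n.+1) *: msum n
  + \sum_(pi in matchings n.+1 | unmatchedL pi ord_max && ~~ unmatchedU pi ord_max) mweight pi.
Proof.
rewrite -msum_unmatched -scaleNr -msum_matchedL addrAC.
rewrite [LHS](bigID (fun pi => unmatchedL pi ord_max)) /=; congr (_ + _).
rewrite [LHS](bigID (fun pi => unmatchedU pi ord_max)) /=.
by congr (_ + _); apply: eq_bigl => pi; rewrite andbA.
Qed.

Lemma msum1 : msum 1 = 'X - y%:P.
Proof.
rewrite msumS msum0 mulr1 /qint big_ord1 mulr1 alg_polyC big1 ?addr0 //.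
move=> pi /and3P[_ /forall_inP L /forall_inPn[[a b] /L]].
(* In degree one any edge ends at the only lower vertex, which is assumed unmatched. *)
by rewrite (ord1 ord_max) (ord1 (a, b).2) eqxx.
Qed.

Lemma msumSS n : msum n.+2 =
  ('X - (y * qint q n.+2)%:P - (qint q n.+1)%:P) * msum n.+1
  - (y * qint q n.+1 ^+ 2)%:P * msum n.
Proof.
rewrite msumS msum_unmatchedL_matchedU -!mul_polyC !(polyCM, polyCN, polyC_exp); ring.
Qed.

Lemma qLaguerre_msum n : qLaguerre q y n = msum n.
Proof.
(* The recurrence has order two, so the induction carries two consecutive values. *)
suff [] : qLaguerre q y n = msum n /\ qLaguerre q y n.+1 = msum n.+1 by [].
elim: n => [|n [IHn IHn1]]; first by rewrite msum0 msum1.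
by split=> //; rewrite msumSS -IHn -IHn1.
Qed.

End Weight.

Theorem theorem2p4 (R : comNzRingType) (q y : R) (n : nat) :
  qLaguerre q y n =
    \sum_(pi in matchings n)
      ((-1) ^+ #|pi| * y ^+ bwex pi * q ^+ (bwt pi + cross pi)%N)
        *: 'X^(n - #|pi|).
Proof. exact: qLaguerre_msum. Qed.
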